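(* Let $t,h\ge 2$, let $\mathbf{d}=(d_1,\ldots,d_{t-1})\in(\mathbb{N}\setminus\{0\})^{t-1}$ and $\mathbf{d}'=(d'_1,\ldots,d'_{h-1})\in(\mathbb{N}\setminus\{0\})^{h-1}$, and let $g,g'\in\mathbb{N}$. Assume that $\mathbf{d}$ is a $(g,t)$-Buchweitz sequence, that $\mathbf{d}'$ is a $(g',h)$-Buchweitz sequence, and that the following conditions hold: \begin{enumerate} \item $g\ge 2\sum_{i=1}^{t-1}d_i+t+1$ and $\#\big\{\sum_{i=n}^{t-1}d_i+\sum_{j=l}^{t-1}d_j \mid n,l\in\{1,\ldots,t\}\big\}>3(t-1)$; \item $g'\ge 2\sum_{i=1}^{h-1}d'_i+h+1$ and $\#\big\{\sum_{i=n}^{h-1}d'_i+\sum_{j=l}^{h-1}d'_j \mid n,l\in\{1,\ldots,h\}\big\}>3(h-1)$ \end{enumerate} (empty sums are $0$). Then for every integer $k\ge 1$ with $d'_{h-1}>k$, the sequence $$\mathbf{d}''=(d'_1,\ldots,d'_{h-1},k,d_1,\ldots,d_{t-1})$$ is a $(g'',t+h)$-Buchweitz sequence for every integer $g''\ge g+g'+2k-1$.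
   Context: A numerical semigroup $H$ is an additive submonoid of $\mathbb{N}=\{0,1,2,\ldots\}$ whose set of gaps $G(H)=\mathbb{N}\setminus H$ is finite. Its genus is $g(H)=\#G(H)$ and its multiplicity $m(H)$ is its least positive element. The set of pseudo-Frobenius numbers is $PF(H)=\{x\in G(H)\mid x+h\in H \text{ for all } h\in H\setminus\{0\}\}$, and the type is $t(H)=\#PF(H)$. $H$ is a PF-semigroup if $G(H)=\{1,\ldots,g(H)-t(H)\}\sqcup PF(H)$ (disjoint union) and $\min PF(H)>m(H)$ (in particular $PF(H)\neq\emptyset$). $H$ is 2-Buchweitz if $\#G_2(H)>3(g(H)-1)$, where $G_2(H)=\{x+y\mid x,y\in G(H)\}$. For $\mathbf{d}=(d_1,\ldots,d_{t-1})\in(\mathbb{N}\setminus\{0\})^{t-1}$, we say $\mathbf{d}$ is a $(g,t)$-Buchweitz sequence if there exists a 2-Buchweitz PF-semigroup $H$ of genus $g$ and type $t$ whose gap set is $$G(H)=\{1,\ldots,g-t\}\cup\Big\{2m-1-\sum_{i=n}^{t-1}d_i \;\Big|\; n\in\{1,\ldots,t\}\Big\},\qquad m=g-t+1,$$ where the empty sum (for $n=t$) is $0$. *)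

(* Defs.v *)
From mathcomp Require Import all_boot all_order all_algebra finmap.
From mathcomp Require Import boolp classical_sets functions cardinality.

Set Implicit Arguments.
Unset Strict Implicit.
Unset Printing Implicit Defensive.

Local Open Scope classical_set_scope.
Local Open Scope nat_scope.

(* Meaningful only for finite sets: [fset_set A] is empty when A is infinite. *)
Definition card_set (A : set nat) : nat := #|` fset_set A|%fset.

(* Meaningful only for nonempty sets: the default value is 0. *)
Definition min_set (A : set nat) : nat :=
  xget 0 [set m | A m /\ forall x, A x -> m <= x].

Definition numerical_semigroup (H : set nat) : Prop :=
  [/\ H 0, forall x y, H x -> H y -> H (x + y) & finite_set (~` H)].

Definition gaps (H : set nat) : set nat := ~` H.

Definition genus (H : set nat) : nat := card_set (gaps H).

Definition multiplicity (H : set nat) : nat := min_set (H `\ 0).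

Definition PF (H : set nat) : set nat :=
  [set x | gaps H x /\ forall h, (H `\ 0) h -> H (x + h)].

Definition semigroup_type (H : set nat) : nat := card_set (PF H).

Definition PF_semigroup (H : set nat) : Prop :=
  let I := [set x | 1 <= x <= genus H - semigroup_type H] in
  [/\ numerical_semigroup H,
      gaps H = I `|` PF H,
      I `&` PF H = set0,
      PF H !=set0
    & multiplicity H < min_set (PF H)].

Definition gaps2 (H : set nat) : set nat :=
  [set x + y | x in gaps H & y in gaps H].

(* The inequality is stated over the integers, so that 3 (g - 1) is not
   truncated when g = 0. *)
Definition two_Buchweitz (H : set nat) : Prop :=
  (3 * ((genus H)%:Z - 1) < (card_set (gaps2 H))%:Z)%R.

Definition positive_seq (n : nat) (d : seq nat) : Prop :=
  size d = n /\ all (fun x => 0 < x) d.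

(* A sequence (d_1, ..., d_n) is indexed from 1: [entry d i] is d_i. *)
Definition entry (d : seq nat) (i : nat) : nat := nth 0 d i.-1.

(* d_n + ... + d_{t-1} *)
Definition tail_sum (t : nat) (d : seq nat) (n : nat) : nat :=
  \sum_(n <= i < t) entry d i.

Definition tail_sums2 (t : nat) (d : seq nat) : set nat :=
  [set tail_sum t d n + tail_sum t d l
    | n in [set n | 1 <= n <= t] & l in [set l | 1 <= l <= t]].

(* Truncated subtraction is harmless here: t <= g because PF(H) is contained in
   G(H), and if d_n + ... + d_{t-1} >= 2m - 1 for some n, then the set contains
   a nonpositive integer (truncated to 0) and so is not the gap set of a
   semigroup, with or without truncation. *)
Definition prescribed_gaps (g t : nat) (d : seq nat) : set nat :=
  let m := g - t + 1 in
  [set x | 1 <= x <= g - t] `|`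
  [set 2 * m - 1 - tail_sum t d n | n in [set n | 1 <= n <= t]].

Definition Buchweitz_seq (g t : nat) (d : seq nat) : Prop :=
  positive_seq t.-1 d /\
  exists H : set nat,
    [/\ PF_semigroup H, two_Buchweitz H, genus H = g, semigroup_type H = t
      & gaps H = prescribed_gaps g t d].

(* Main.v *)
(* Let [A] be the set of tail sums of [d], with maximum [D], and [m = g-t+1].
   As soon as [2 D + 2 <= m], the complement of
   [{1, ..., m-1} U {2 m - 1 - a | a in A}] is a PF-semigroup of genus [g] and
   type [t], and the sums of two gaps are exactly [{2, ..., 3 m - 2}] and the
   [4 m - 2 - s] with [s] in [A + A]. So the 2-Buchweitz condition amounts to
   [#(A + A) > 3 (t - 1)]. The tail sums of [d''] form the set
   [A'' = A U (D + k + A')], and [A'' + A''] contains disjoint translates of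
   [A + A] and [A' + A'] and, since [k < d'_{h-1}], at least two further
   elements; hence [#(A'' + A'') > 3 (t + h - 1)]. *)
Require Import Defs.
From mathcomp Require Import all_boot.
From mathcomp Require Import finmap zify.
From mathcomp Require Import boolp classical_sets functions cardinality.

Set Implicit Arguments.
Unset Strict Implicit.
Unset Printing Implicit Defensive.

Local Open Scope classical_set_scope.
Local Open Scope nat_scope.

(** * Cardinalities and minima of sets of naturals *)

Lemma card_setU_disjoint (A B : set nat) :
  finite_set A -> finite_set B -> (forall x, A x -> B x -> False) ->
  card_set (A `|` B) = card_set A + card_set B.
Proof.
move=> fA fB AB; rewrite /card_set fset_setU// cardfsU -fset_setI//.
suff -> : A `&` B = set0 by rewrite fset_set0 cardfs0 subn0.
by apply/seteqP; split=> x //= [Ax Bx]; apply: AB Ax Bx.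
Qed.

Lemma card_set_image (f : nat -> nat) (A : set nat) : finite_set A ->
  (forall x y, A x -> A y -> f x = f y -> x = y) ->
  card_set (f @` A) = card_set A.
Proof.
move=> fA f_inj; rewrite /card_set fset_set_image//; apply: card_in_imfset => x y.
by rewrite !in_fset_set// !inE; apply: f_inj.
Qed.

Lemma leq_card_set (A B : set nat) :
  finite_set B -> A `<=` B -> card_set A <= card_set B.
Proof.
move=> fB AB; apply: fsubset_leq_card; rewrite -fset_set_sub//.
exact: sub_finite_set fB.
Qed.

Lemma card_set1 (x : nat) : card_set [set x] = 1.
Proof. by rewrite /card_set fset_set1 cardfs1. Qed.

Lemma finite_set_bounded (A : set nat) (n : nat) :
  (forall x, A x -> x < n) -> finite_set A.
Proof. by move=> An; apply: sub_finite_set (finite_II n). Qed.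

Lemma card_set_interval (a n : nat) : card_set [set x | a <= x < a + n] = n.
Proof.
have -> : [set x | a <= x < a + n] = (addn a) @` `I_n.
  apply/seteqP; split=> [x /= ax|_ [x /= xn <-]]; last by lia.
  by exists (x - a) => /=; lia.
rewrite card_set_image//; last by move=> x y _ _ /addnI.
elim: n => [|n IHn]; first by rewrite II0 /card_set fset_set0 cardfs0.
rewrite IIS card_setU_disjoint//; last by move=> x /= /[swap] ->; rewrite ltnn.
by rewrite IHn card_set1 addn1.
Qed.

Lemma min_setE (A : set nat) (m : nat) :
  A m -> (forall x, A x -> m <= x) -> min_set A = m.
Proof.
move=> Am mA; apply: xget_unique => // n [An nA].
by apply/eqP; rewrite eqn_leq nA// mA.
Qed.

(** * Sumsets and their growth under gluing *)

Definition sumset (A B : set nat) : set nat := [set x + y | x in A & y in B].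

(** Apart from cardinalities, this is all that the study of gap sets uses of the set of tail
    sums. *)
Definition spans (D : nat) (A : set nat) : Prop :=
  [/\ A 0, A D & forall a, A a -> a <= D].

Lemma finite_spans (D : nat) (A : set nat) : spans D A -> finite_set A.
Proof. by case=> _ _ AD; apply: (@finite_set_bounded _ D.+1) => x /AD. Qed.

Lemma finite_sumset (A B : set nat) :
  finite_set A -> finite_set B -> finite_set (sumset A B).
Proof. exact: finite_image2. Qed.

(* The two extra elements are [2 D + k = D + (D + k + 0)] and
   [2 D + k + b = D + (D + k + b)]: the first lies in the gap between [2 D]
   and [2 (D + k)], and the second, as [k < b], between [2 (D + k)] and the
   next element of the translate of [sumset B B]. *)
Lemma card_sumset_glue (D E k b : nat) (A B : set nat) :
  spans D A -> spans E B -> B b -> (forall x, B x -> x = 0 \/ b <= x) ->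
  0 < k < b ->
  card_set (sumset A A) + card_set (sumset B B) + 2 <=
  card_set (sumset (A `|` [set D + k + x | x in B])
                   (A `|` [set D + k + x | x in B])).
Proof.
move=> sA sB Bb b_min kb.
have [fA fB] := (finite_spans sA, finite_spans sB).
case: sA sB => [A0 AD ltA] [B0 BE ltB].
have fAA := finite_sumset fA fA; have fBB := finite_sumset fB fB.
set C := A `|` _.
have fC : finite_set C by rewrite finite_setU; split=> //; exact: finite_image.
have fBB' : finite_set [set 2 * (D + k) + x | x in sumset B B].
  exact: finite_image.
have -> : card_set (sumset A A) + card_set (sumset B B) + 2 =
    card_set (sumset A A `|` [set 2 * (D + k) + x | x in sumset B B]
      `|` ([set 2 * D + k] `|` [set 2 * D + k + b])).
  rewrite card_setU_disjoint ?finite_setU//; last first.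
    move=> x [[y Ay [z Az <-]]|[_ [y By [z Bz <-]] <-]] /= [].
    - by have := ltA _ Ay; have := ltA _ Az; lia.
    - by have := ltA _ Ay; have := ltA _ Az; lia.
    - by lia.
    - by have := b_min _ By; have := b_min _ Bz; lia.
  rewrite card_setU_disjoint//; last first.
    move=> _ [y Ay [z Az <-]] [w _].
    by have := ltA _ Ay; have := ltA _ Az; lia.
  rewrite card_setU_disjoint//; last by move=> x /= ->; lia.
  by rewrite !card_set1 card_set_image// => x y _ _ /addnI.
apply: leq_card_set; first exact: finite_sumset.
have CB x : B x -> C (D + k + x) by right; exists x.
move=> x [[[y Ay [z Az <-]]|[_ [y By [z Bz <-]] <-]]|[->|->]].
- by exists y; [left|exists z; [left|]].
- exists (D + k + y); first exact: CB.
  by exists (D + k + z); [exact: CB|lia].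
- exists D; first by left.
  by exists (D + k + 0); [exact: CB|lia].
- exists D; first by left.
  by exists (D + k + b); [exact: CB|lia].
Qed.

(** * Semigroups defined by their gaps *)

(** If [spans D A] and [2 * D + 2 <= m], the second block lies between [2 * m - 1 - D > m] and
    [2 * m - 1]: the blocks are disjoint and no subtraction truncates. *)
Definition gap_set (m : nat) (A : set nat) : set nat :=
  [set x | 1 <= x < m] `|` [set 2 * m - 1 - a | a in A].

(** Two nonzero non-gaps are each at least [m], so their sum exceeds every gap. *)
Lemma numerical_semigroup_gap_setC (m D : nat) (A : set nat) :
  spans D A -> 2 * D + 2 <= m -> numerical_semigroup (~` gap_set m A).
Proof.
case=> A0 AD ltA Dm; have gt0 x : gap_set m A x -> 0 < x < 2 * m.
  by case=> /= [|[a /ltA ? <-]]; lia.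
split=> [/gt0//|x y Hx Hy|].
- have [->|x0] := eqVneq x 0; first exact: Hy.
  have [->|y0] := eqVneq y 0; first by rewrite addn0.
  have mx : m <= x by rewrite leqNgt; apply/negP=> xm; apply: Hx; left=> /=; lia.
  have my : m <= y by rewrite leqNgt; apply/negP=> ym; apply: Hy; left=> /=; lia.
  by move=> /gt0; lia.
- by rewrite setCK; apply: (@finite_set_bounded _ (2 * m)) => x /gt0; lia.
Qed.

(* For [1 <= x < m], one of [x + h = 2 m - 1] and [x + h = 2 m - 1 - D] has a
   solution [h] in the semigroup, so that [x] is not pseudo-Frobenius. *)
Lemma PF_gap_setC (m D : nat) (A : set nat) :
  spans D A -> 2 * D + 2 <= m ->
  PF (~` gap_set m A) = [set 2 * m - 1 - a | a in A].
Proof.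
case=> A0 AD ltA Dm; apply/seteqP; split=> x.
- rewrite /PF /gaps setCK => -[[/= xm|//] PFx]; exfalso.
  (* In either case [h] satisfies [m <= h < 2 * m - 1 - D], a range free of gaps. *)
  have [Dx|xD] := leqP (x + D) (m - 1).
  + apply: (PFx (2 * m - 1 - D - x)); last first.
      by right; exists D => //; lia.
    by split=> [[/=|[a Aa]]|/=]; [lia|have := ltA _ Aa; lia|lia].
  + apply: (PFx (2 * m - 1 - x)); last by right; exists 0 => //; lia.
    by split=> [[/=|[a Aa]]|/=]; [lia|have := ltA _ Aa; lia|lia].
- case=> a Aa <-; split; first by rewrite /gaps setCK; right; exists a.
  move=> h [Hh /= h0]; have := ltA _ Aa.
  have mh : m <= h by rewrite leqNgt; apply/negP=> hm; apply: Hh; left=> /=; lia.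
  by move=> aD [/=|[b /ltA]]; lia.
Qed.

Lemma card_set_reflect (n D : nat) (A : set nat) :
  spans D A -> D <= n -> card_set [set n - a | a in A] = card_set A.
Proof.
move=> sA; have fA := finite_spans sA; case: sA => A0 AD ltA Dm.
by rewrite card_set_image// => x y /ltA ? /ltA ?; lia.
Qed.

Lemma card_gap_set (m D : nat) (A : set nat) :
  spans D A -> 2 * D + 2 <= m -> card_set (gap_set m A) = m - 1 + card_set A.
Proof.
move=> sA Dm; rewrite /gap_set.
rewrite card_setU_disjoint; last 3 first.
- by apply: (@finite_set_bounded _ m) => x /=; lia.
- exact: finite_image (finite_spans sA).
- by case: sA => A0 AD ltA x /= xm [a /ltA]; lia.
rewrite (card_set_reflect sA); last by lia.
congr (_ + _); rewrite -[RHS](card_set_interval 1); congr card_set.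
by apply/seteqP; split=> x /=; lia.
Qed.

Lemma sumset_spans (D : nat) (A : set nat) :
  spans D A -> spans (2 * D) (sumset A A).
Proof.
case=> A0 AD ltA; split; first by exists 0 => //; exists 0.
- by exists D => //; exists D => //; lia.
- by move=> _ [x /ltA xD [y /ltA yD <-]]; lia.
Qed.

(* Sums of two gaps below [m], and of one such gap with [2 m - 1] or
   [2 m - 1 - D], already fill the interval from [2] to [3 m - 2]. *)
Lemma sumset_gap_set (m D : nat) (A : set nat) :
  spans D A -> 0 < D -> 2 * D + 2 <= m ->
  sumset (gap_set m A) (gap_set m A) =
  [set x | 2 <= x < 2 + 3 * (m - 1)] `|`
  [set 4 * m - 2 - s | s in sumset A A].
Proof.
case=> A0 AD ltA D0 Dm.
have small x : 0 < x < m -> gap_set m A x by left.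
have large a : A a -> gap_set m A (2 * m - 1 - a) by right; exists a.
apply/seteqP; split=> [_ [x Gx [y Gy <-]]|z].
  case: Gx Gy => [/= xm|[a Aa <-]] [/= ym|[b Ab <-]].
  - by left=> /=; lia.
  - by left=> /=; have := ltA _ Ab; lia.
  - by left=> /=; have := ltA _ Aa; lia.
  - right; exists (a + b); first by exists a => //; exists b.
    by have := ltA _ Aa; have := ltA _ Ab; lia.
case=> [/= zm|[_ [a Aa [b Ab <-]] <-]]; last first.
  exists (2 * m - 1 - a); first exact: large.
  exists (2 * m - 1 - b); first exact: large.
  by have := ltA _ Aa; have := ltA _ Ab; lia.
have [z1|z1] := leqP z m.
  by exists 1; [apply: small; lia|exists (z - 1); [apply: small|]; lia].
have [z2|z2] := leqP z (2 * m - 2).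
  exists (m - 1); first by apply: small; lia.
  by exists (z - (m - 1)); [apply: small|]; lia.
(* Only [z = 2 * m - 1] is left here: too large for two gaps below [m], too small for [2 * m - 1]
   plus a gap. *)
have [z3|z3] := leqP z (2 * m - 1).
  exists D; first by apply: small; lia.
  by exists (2 * m - 1 - D); [exact: large|lia].
exists (z - (2 * m - 1)); first by apply: small; lia.
by exists (2 * m - 1 - 0); [exact: large|lia].
Qed.

Lemma card_sumset_gap_set (m D : nat) (A : set nat) :
  spans D A -> 0 < D -> 2 * D + 2 <= m ->
  card_set (sumset (gap_set m A) (gap_set m A)) =
  3 * (m - 1) + card_set (sumset A A).
Proof.
move=> sA D0 Dm; have sAA := sumset_spans sA.
rewrite (sumset_gap_set sA)// card_setU_disjoint; last 3 first.
- by apply: (@finite_set_bounded _ (3 * m)) => x /=; lia.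
- exact: finite_image (finite_spans sAA).
- by case: sAA => _ _ ltA x /= xm [a /ltA]; lia.
by rewrite card_set_interval (card_set_reflect sAA)//; lia.
Qed.

Lemma PF_semigroup_gap_setC (m D : nat) (A : set nat) :
  spans D A -> 2 * D + 2 <= m -> PF_semigroup (~` gap_set m A).
Proof.
move=> sA Dm; rewrite /PF_semigroup /genus /semigroup_type /gaps setCK.
rewrite (PF_gap_setC sA)// (card_gap_set sA)// (card_set_reflect sA); last by lia.
have -> : [set x | 0 < x <= m - 1 + card_set A - card_set A] =
          [set x | 0 < x < m].
  by apply/seteqP; split=> x /=; lia.
case: (sA) => A0 AD ltA; split=> //.
- exact: numerical_semigroup_gap_setC Dm.
- by apply/seteqP; split=> x //= [/= xm [a /ltA]]; lia.
- by exists (2 * m - 1 - 0); exists 0.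
(* The multiplicity is [m], which lies between the two blocks of gaps; the least pseudo-Frobenius
   number is [2 * m - 1 - D]. *)
- rewrite /multiplicity (@min_setE _ m); last 2 first.
  + by split=> [[/=|[a /ltA]]|/=]; lia.
  + move=> x [Hx /= x0]; rewrite leqNgt; apply/negP=> xm.
    by apply: Hx; left=> /=; lia.
  rewrite (@min_setE _ (2 * m - 1 - D)); [by lia|by exists D|].
  by move=> _ [a /ltA aD <-]; lia.
Qed.

(** The terms [3 * (m - 1)] cancel, so the inequality left on [A] does not involve [m]; this is why
    the genus may be arbitrarily large. *)
Lemma two_Buchweitz_gap_setC (m D : nat) (A : set nat) :
  spans D A -> 0 < D -> 2 * D + 2 <= m ->
  3 * (card_set A - 1) < card_set (sumset A A) ->
  two_Buchweitz (~` gap_set m A).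
Proof.
move=> sA D0 Dm AA; rewrite /two_Buchweitz /gaps2 /genus /gaps setCK.
rewrite -/(sumset _ _) (card_sumset_gap_set sA)// (card_gap_set sA)//.
lia.
Qed.

(** * Tail sums of a sequence *)

Definition tail_set (t : nat) (d : seq nat) : set nat :=
  [set tail_sum t d n | n in [set n | 1 <= n <= t]].

Lemma tail_sums2E (t : nat) (d : seq nat) :
  tail_sums2 t d = sumset (tail_set t d) (tail_set t d).
Proof.
apply/seteqP; split=> [_ [n tn [l tl <-]]|_ [_ [n tn <-] [_ [l tl <-] <-]]].
  by exists (tail_sum t d n); [exists n|exists (tail_sum t d l) => //; exists l].
by exists n => //; exists l.
Qed.

Lemma prescribed_gapsE (g t : nat) (d : seq nat) :
  prescribed_gaps g t d = gap_set (g - t + 1) (tail_set t d).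
Proof.
rewrite /prescribed_gaps /gap_set /tail_set image_comp; congr (_ `|` _).
by apply/seteqP; split=> x /=; lia.
Qed.

Lemma tail_sum_cat (t : nat) (d : seq nat) (n l : nat) :
  n <= l <= t ->
  tail_sum t d n = \sum_(n <= i < l) entry d i + tail_sum t d l.
Proof. by case/andP; apply: big_cat_nat. Qed.

Lemma entry_gt0 (t : nat) (d : seq nat) (i : nat) :
  positive_seq t.-1 d -> 1 <= i < t -> 0 < entry d i.
Proof. by case=> sd /allP d0 it; apply/d0/mem_nth; rewrite sd; lia. Qed.

Lemma tail_sum_entry_le (t : nat) (d : seq nat) (n l : nat) :
  n < l <= t -> entry d l.-1 + tail_sum t d l <= tail_sum t d n.
Proof.
move=> nl; rewrite (@tail_sum_cat t d n l) ?leq_add2r; last by lia.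
(* Only the upper bound of the sum is turned into a successor, to split off its last term. *)
have [ln nl'] : l = l.-1.+1 /\ n <= l.-1 by lia.
by rewrite [X in index_iota _ X]ln big_nat_recr//= leq_addl.
Qed.

Lemma spans_tail_set (t : nat) (d : seq nat) :
  1 <= t -> spans (tail_sum t d 1) (tail_set t d).
Proof.
move=> t1; split.
- by exists t => /=; [lia|rewrite /tail_sum big_geq].
- by exists 1 => /=; lia.
- by move=> _ [n /= tn <-]; rewrite (@tail_sum_cat t d 1 n)// leq_addl.
Qed.

(** Positive entries make the tail sums strictly decreasing in the starting index. *)
Lemma card_tail_set (t : nat) (d : seq nat) :
  positive_seq t.-1 d -> card_set (tail_set t d) = t.
Proof.
move=> pd; rewrite card_set_image; last 2 first.
- by apply: (@finite_set_bounded _ t.+1) => x /=; lia.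
- have lt n l : 1 <= n -> n < l <= t -> tail_sum t d l < tail_sum t d n.
    move=> n1 nl; have := @tail_sum_entry_le t d n l nl.
    have : 0 < entry d l.-1 by apply: entry_gt0 pd _; lia.
    by lia.
  move=> n l /= nt lt'; case: (ltngtP n l) => // nl.
    by have := lt n l; lia.
  by have := lt l n; lia.
exact: (card_set_interval 1).
Qed.

Lemma tail_set_last (t : nat) (d : seq nat) :
  2 <= t -> tail_set t d (entry d (t - 1)).
Proof.
move=> t2; exists (t - 1) => /=; first by lia.
have [n ->] : exists n, t = n.+1 by exists t.-1; lia.
by rewrite subn1 /tail_sum /= big_nat1.
Qed.

(** With [tail_set_last], this lets the last entry play the role of [b] in [card_sumset_glue]. *)
Lemma tail_set_min (t : nat) (d : seq nat) (x : nat) :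
  tail_set t d x -> x = 0 \/ entry d (t - 1) <= x.
Proof.
case=> n /= tn <-; have [nt|nt] := ltnP n t.
  by right; have := @tail_sum_entry_le t d n t; rewrite -subn1; lia.
by left; rewrite /tail_sum big_geq.
Qed.

(** The entry [k] has index [h]: a tail starting later is a tail of [d], while one starting at
    [n <= h] contains [k] and all of [d]. *)
Lemma tail_set_cat (t h : nat) (d d' : seq nat) (k : nat) :
  1 <= t -> 1 <= h -> size d' = h.-1 ->
  tail_set (t + h) (d' ++ k :: d) =
  tail_set t d `|` [set tail_sum t d 1 + k + x | x in tail_set h d'].
Proof.
move=> t1 h1 sd'.
have hi n : 1 <= n -> tail_sum (t + h) (d' ++ k :: d) (n + h) = tail_sum t d n.
  move=> n1; rewrite /tail_sum big_addn addnK big_nat_cond [RHS]big_nat_cond.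
  apply: eq_bigr => i /andP[ni _]; rewrite /entry nth_cat sd'.
  have [-> -> //] : ((i + h).-1 < h.-1) = false /\ (i + h).-1 - h.-1 = i.-1.+1.
  by lia.
have lo n : 1 <= n <= h ->
    tail_sum (t + h) (d' ++ k :: d) n = tail_sum t d 1 + k + tail_sum h d' n.
  (* The cut falls just after [k], in the form to which [hi] applies with index 1. *)
  move=> nh; rewrite (@tail_sum_cat _ _ n (1 + h)); last by lia.
  rewrite hi// add1n big_nat_recr /=; last by lia.
  rewrite [in X in _ + X + _]/entry nth_cat sd' ltnn subnn /=.
  suff -> : \sum_(n <= i < h) entry (d' ++ k :: d) i = tail_sum h d' n by lia.
  rewrite /tail_sum big_nat_cond [RHS]big_nat_cond; apply: eq_bigr => i /andP[ni _].
  by rewrite /entry nth_cat sd'; have -> : i.-1 < h.-1 by lia.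
apply/seteqP; split=> [_ [n /= nt <-]|_ [[n /= nt <-]|[_ [n /= nh <-] <-]]].
- have [nh|hn] := leqP n h.
    have nh' : 1 <= n <= h by lia.
    by right; exists (tail_sum h d' n); [exists n|rewrite lo].
  left; exists (n - h) => /=; first by lia.
  by rewrite -hi ?subnK//; lia.
- by exists (n + h) => /=; [lia|rewrite hi//; lia].
- by exists n => /=; [lia|rewrite lo].
Qed.

(** * A sufficient criterion, and the concatenated sequence *)

(** For [m = g - t + 1] the bound on [g] is exactly [2 * D + 2 <= m], with [D] the full sum of
    [d]. *)
Lemma Buchweitz_seq_sumset (g t : nat) (d : seq nat) :
  2 <= t -> positive_seq t.-1 d -> 2 * tail_sum t d 1 + t + 1 <= g ->
  3 * (t - 1) < card_set (tail_sums2 t d) -> Buchweitz_seq g t d.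
Proof.
move=> t2 pd gD; rewrite tail_sums2E => AA; split=> //.
have sA := @spans_tail_set t d (ltnW t2); have cA := card_tail_set pd.
have mD : 2 * tail_sum t d 1 + 2 <= g - t + 1 by lia.
have D0 : 0 < tail_sum t d 1.
  have := @tail_sum_entry_le t d 1 2 t2.
  by have := @entry_gt0 t d 1 pd t2; rewrite /=; lia.
exists (~` gap_set (g - t + 1) (tail_set t d)); split.
- exact: PF_semigroup_gap_setC mD.
- by apply: two_Buchweitz_gap_setC mD _; rewrite ?cA.
- by rewrite /genus /gaps setCK (card_gap_set sA)// cA; lia.
- by rewrite /semigroup_type (PF_gap_setC sA)// (card_set_reflect sA)//; lia.
- by rewrite /gaps setCK prescribed_gapsE.
Qed.

Theorem theorem3p6 (t h : nat) (d d' : seq nat) (g g' : nat)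
    (ht : 2 <= t) (hh : 2 <= h)
    (hd : positive_seq t.-1 d) (hd' : positive_seq h.-1 d')
    (Bd : Buchweitz_seq g t d) (Bd' : Buchweitz_seq g' h d')
    (hg : 2 * (\sum_(1 <= i < t) entry d i) + t + 1 <= g)
    (hs : 3 * (t - 1) < card_set (tail_sums2 t d))
    (hg' : 2 * (\sum_(1 <= i < h) entry d' i) + h + 1 <= g')
    (hs' : 3 * (h - 1) < card_set (tail_sums2 h d')) :
  forall k : nat, 1 <= k -> k < entry d' (h - 1) ->
  forall g'' : nat, g + g' + 2 * k - 1 <= g'' ->
  Buchweitz_seq g'' (t + h) (d' ++ k :: d).
Proof.
move=> k k1 kd' g'' gg''.
have [t1 h1] : 1 <= t /\ 1 <= h by lia.
have [sd' d'0] := hd'; have [sd d0] := hd.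
have E := @tail_set_cat t h d d' k t1 h1 sd'.
rewrite -/(tail_sum t d 1) in hg; rewrite -/(tail_sum h d' 1) in hg'.
(* With this bound, adding [hg] and [hg'] gives exactly the threshold [g + g' + 2 * k - 1] for
   [g'']. *)
have D'' : tail_sum (t + h) (d' ++ k :: d) 1 <=
    tail_sum t d 1 + k + tail_sum h d' 1.
  have th1 : 1 <= t + h by lia.
  have [_ + _] := @spans_tail_set (t + h) (d' ++ k :: d) th1; rewrite E.
  have [_ _ ltA] := @spans_tail_set t d t1.
  have [_ _ ltB] := @spans_tail_set h d' h1.
  by case=> [/ltA|[x /ltB]]; lia.
apply: Buchweitz_seq_sumset; [by lia| |by lia|].
  by split; [rewrite size_cat /= sd sd'; lia|rewrite all_cat /= d'0 d0 k1].
rewrite tail_sums2E E; rewrite !tail_sums2E in hs hs'.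
have k_gap : 0 < k < entry d' (h - 1) by rewrite k1.
(* The count is tight: [(3 * (t - 1) + 1) + (3 * (h - 1) + 1) + 2 = 3 * (t + h - 1) + 1]. *)
have := card_sumset_glue (spans_tail_set d t1) (spans_tail_set d' h1)
  (tail_set_last d' hh) (@tail_set_min h d') k_gap.
lia.
Qed.
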